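(* Consider, over the horizon $t=0,\dots,T$, the linear time-varying system $x_{t+1}=A_tx_t+B_tu_t+w_t$ with $x_t,w_t\in\mathbb{R}^n$, $u_t\in\mathbb{R}^p$, under a block-lower-triangular state-feedback law $\mathbf{K}$, i.e. $\mathbf{u}=\mathbf{K}\mathbf{x}$. Then: 1. The affine subspace of pairs of block-lower-triangular matrices $\{\mathbf{\Phi}_x,\mathbf{\Phi}_u\}$ defined by $$\begin{bmatrix} I-Z\mathcal{A} & -Z\mathcal{B}\end{bmatrix}\begin{bmatrix}\mathbf{\Phi}_x\\ \mathbf{\Phi}_u\end{bmatrix}=I$$ parameterizes all possible system responses $\begin{bmatrix}\mathbf{x}\\ \mathbf{u}\end{bmatrix}=\begin{bmatrix}\mathbf{\Phi}_x\\ \mathbf{\Phi}_u\end{bmatrix}\mathbf{w}$; that is, a pair of block-lower-triangular matrices satisfies this equation if and only if it is the closed-loop system response achieved by some block-lower-triangular $\mathbf{K}$. 2. For any block-lower-triangular matrices $\{\mathbf{\Phi}_x,\mathbf{\Phi}_u\}$ satisfying this equation, the controller $\mathbf{K}=\mathbf{\Phi}_u\mathbf{\Phi}_x^{-1}$ achieves the desired response, i.e. under $\mathbf{u}=\mathbf{K}\mathbf{x}$ one has $\mathbf{x}=\mathbf{\Phi}_x\mathbf{w}$ and $\mathbf{u}=\mathbf{\Phi}_u\mathbf{w}$.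
   Context: Signals are stacked over the horizon: $\mathbf{x}=(x_0,x_1,\dots,x_T)$, $\mathbf{u}=(u_0,u_1,\dots,u_T)$, $\mathbf{w}=(x_0,w_0,w_1,\dots,w_{T-1})$ (block column vectors with $T+1$ blocks). $Z$ is the block-downshift operator: the $(T+1)\times(T+1)$ block matrix (with $n\times n$ blocks) having identity matrices on the first block sub-diagonal and zeros elsewhere. $\mathcal{A}=\mathrm{blkdiag}(A_0,\dots,A_{T-1},0)$ and $\mathcal{B}=\mathrm{blkdiag}(B_0,\dots,B_{T-1},0)$. The dynamics are then $\mathbf{x}=Z\mathcal{A}\mathbf{x}+Z\mathcal{B}\mathbf{u}+\mathbf{w}$. The matrix $\mathbf{K}$ is a $(T+1)\times(T+1)$ block-lower-triangular matrix with $p\times n$ blocks (a causal linear time-varying controller); $\mathbf{\Phi}_x$ and $\mathbf{\Phi}_u$ are $(T+1)\times(T+1)$ block-lower-triangular with $n\times n$ and $p\times n$ blocks respectively. The system response achieved by $\mathbf{K}$ is the pair of closed-loop maps $\mathbf{w}\mapsto\mathbf{x}$ and $\mathbf{w}\mapsto\mathbf{u}$, namely $(I-Z(\mathcal{A}+\mathcal{B}\mathbf{K}))^{-1}$ and $\mathbf{K}(I-Z(\mathcal{A}+\mathcal{B}\mathbf{K}))^{-1}$. *)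

(* Defs.v *)
From mathcomp Require Import all_boot all_order all_algebra.
From mathcomp Require Import reals.

Set Implicit Arguments.
Unset Strict Implicit.
Unset Printing Implicit Defensive.

Import GRing.Theory.
Local Open Scope ring_scope.

(* (T+1) x (T+1) block matrices with a x b blocks.  Block indices range over
   'I_T.+1, i.e. over the times 0, ..., T. *)
Notation blockM R T a b :=
  'M[R]_(\sum_(i < T.+1) a, \sum_(j < T.+1) b) (only parsing).

Section Defs.
Variables (R : realType) (T : nat).

Definition block_lower_triangular (a b : nat) (M : blockM R T a b) : Prop :=
  forall i j : 'I_T.+1, (i < j)%N ->
    @submxblock R T.+1 T.+1 (fun=> a) (fun=> b) M i j = 0.

Definition downshift (n : nat) : blockM R T n n :=
  \mxblock_(i < T.+1, j < T.+1)
    (if i == j.+1 :> nat then 1%:M else 0 : 'M[R]_n).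

(* blkdiag(D_0, ..., D_{T-1}, 0), with possibly rectangular blocks;
   [unlift ord_max i] is [Some t] with t = i when i < T, and [None] when
   i = T. *)
Definition blkdiag0 (a b : nat) (D : 'I_T -> 'M[R]_(a, b)) :
    blockM R T a b :=
  \mxblock_(i < T.+1, j < T.+1)
    (if i == j then oapp D 0 (unlift ord_max i) else 0 : 'M[R]_(a, b)).

Definition stack (d : nat) (s : 'I_T.+1 -> 'cV[R]_d) :
    'cV[R]_(\sum_(t < T.+1) d) :=
  \mxcol_(t < T.+1) s t.

(* The stacked disturbance (x_0, w_0, ..., w_{T-1}); [unlift ord0 i] is
   [Some t] with i = t + 1 when 0 < i, and [None] when i = 0. *)
Definition stack_dist (n : nat) (x0 : 'cV[R]_n) (w : 'I_T -> 'cV[R]_n) :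
    'cV[R]_(\sum_(t < T.+1) n) :=
  stack (fun i : 'I_T.+1 => oapp w x0 (unlift ord0 i)).

Variables (n p : nat) (A : 'I_T -> 'M[R]_n) (B : 'I_T -> 'M[R]_(n, p)).

(* For t : 'I_T, [lift ord0 t] is the time t + 1 and [lift ord_max t] is the
   time t, both in 'I_T.+1. *)
Definition ltv_trajectory (x : 'I_T.+1 -> 'cV[R]_n) (u : 'I_T.+1 -> 'cV[R]_p)
    (w : 'I_T -> 'cV[R]_n) : Prop :=
  forall t : 'I_T,
    x (lift ord0 t)
      = A t *m x (lift ord_max t) + B t *m u (lift ord_max t) + w t.

Definition achievability_constraint
    (Phix : blockM R T n n) (Phiu : blockM R T p n) : Prop :=
  row_mx (1%:M - downshift n *m blkdiag0 A) (- (downshift n *m blkdiag0 B))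
    *m col_mx Phix Phiu = 1%:M.

Definition closed_loop_mx (K : blockM R T p n) : blockM R T n n :=
  1%:M - downshift n *m (blkdiag0 A + blkdiag0 B *m K).

(* As [invmx M] is M itself when M is singular, invertibility is made part of
   the definition. *)
Definition system_response (K : blockM R T p n)
    (Phix : blockM R T n n) (Phiu : blockM R T p n) : Prop :=
  [/\ closed_loop_mx K \in unitmx,
      Phix = invmx (closed_loop_mx K)
    & Phiu = K *m invmx (closed_loop_mx K)].

End Defs.

(* Main.v *)
(* [Z M] is strictly block-lower-triangular, hence nilpotent, whenever [M] is
   block-lower-triangular; so [I - Z M] is invertible and its inverse, a finite
   Neumann sum, is block-lower-triangular.  This applies to the closed-loop
   matrix, and also to [Phix] itself: the constraint reads
   [Phix = I + Z (A Phix + B Phiu)], so [Phix] is invertible,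
   [K = Phiu Phix^-1] is causal, and the constraint becomes
   [(I - Z (A + B K)) Phix = I]. *)

Require Import Defs.
From mathcomp Require Import all_boot all_order all_algebra.
From mathcomp Require Import reals.

Set Implicit Arguments.
Unset Strict Implicit.
Unset Printing Implicit Defensive.

Import GRing.Theory.
Local Open Scope ring_scope.

Lemma mulmx1_invmx (R : comUnitRingType) (n : nat) (A B : 'M[R]_n) :
  A *m B = 1%:M -> invmx A = B.
Proof.
by move=> AB; have [UA _] := mulmx1_unit AB; rewrite -(mulKmx UA B) AB mulmx1.
Qed.

(** * Calculus of block bands, and inversion of [1 - N] for [N] strictly block-lower-triangular *)

Section BandedBlockMatrices.
Variable T : nat.

(** Band [0] is block-lower-triangular and band [1] strictly so. Keeping the offset [k] as a
    parameter lets powers be tracked until the band exceeds the matrix, which is how nilpotence is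
    obtained. *)
Definition lower_banded (R : nmodType) (k a b : nat) (M : blockM R T a b) :
    Prop :=
  forall i j : 'I_T.+1, (i < j + k)%N ->
    @submxblock R T.+1 T.+1 (fun=> a) (fun=> b) M i j = 0.

Lemma lower_banded0 (R : nmodType) (k a b : nat) :
  lower_banded k (0 : blockM R T a b).
Proof. by move=> i j _; exact: submxblock0. Qed.

Lemma lower_bandedD (R : nmodType) (k a b : nat) (M N : blockM R T a b) :
  lower_banded k M -> lower_banded k N -> lower_banded k (M + N).
Proof. by move=> hM hN i j ij; rewrite submxblockD hM // hN // addr0. Qed.

Lemma lower_bandedN (R : zmodType) (k a b : nat) (M : blockM R T a b) :
  lower_banded k M -> lower_banded k (- M).
Proof. by move=> hM i j ij; rewrite submxblockN hM // oppr0. Qed.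

Lemma lower_banded_full (R : nmodType) (a b : nat) (M : blockM R T a b) :
  lower_banded T.+1 M -> M = 0.
Proof.
move=> hM; apply/mxblockP => i j.
by rewrite submxblock0 hM // ltn_addl.
Qed.

Lemma submxblock_mul (R : pzSemiRingType) (a b c : nat)
    (M : blockM R T a b) (N : blockM R T b c) (i j : 'I_T.+1) :
  @submxblock R T.+1 T.+1 (fun=> a) (fun=> c) (M *m N) i j =
  \sum_k @submxblock R T.+1 T.+1 (fun=> a) (fun=> b) M i k
    *m @submxblock R T.+1 T.+1 (fun=> b) (fun=> c) N k j.
Proof.
rewrite -{1}[M]submxblockK -{1}[N]submxblockK.
by rewrite mul_mxblock mxblockK.
Qed.

Lemma lower_banded_mul (R : pzSemiRingType) (k l a b c : nat)
    (M : blockM R T a b) (N : blockM R T b c) :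
  lower_banded k M -> lower_banded l N -> lower_banded (k + l) (M *m N).
Proof.
move=> hM hN i j ij; rewrite submxblock_mul big1 // => m _.
(* Each summand has a vanishing factor: either [i < m + k] kills the left one, or
   [m + k <= i < j + (k + l)] gives [m < j + l] and kills the right one. *)
have [im|mi] := ltnP i (m + k); first by rewrite hM // mul0mx.
rewrite hN ?mulmx0 // -(ltn_add2r k).
by rewrite (leq_ltn_trans mi) // -addnA [(l + k)%N]addnC.
Qed.

Lemma lower_banded1 (R : pzSemiRingType) (a : nat) :
  lower_banded 0 (1%:M : blockM R T a a).
Proof.
move=> i j; rewrite addn0 => ij.
by rewrite -mxdiagZ mxblockK; case: eqP ij => // ->; rewrite ltnn.
Qed.

Lemma lower_banded_exp (R : pzSemiRingType) (a m : nat) (N : blockM R T a a) :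
  lower_banded 1 N -> lower_banded m (N ^+ m).
Proof.
move=> hN; elim: m => [|m IHm]; first exact: lower_banded1.
by rewrite exprS -add1n; exact: lower_banded_mul.
Qed.

Lemma lower_banded_sub1_inv (R : comUnitRingType) (a : nat)
    (N : blockM R T a a) : lower_banded 1 N ->
  1%:M - N \in unitmx /\ lower_banded 0 (invmx (1%:M - N)).
Proof.
move=> hN; set P : blockM R T a a := \sum_(m < T.+1) N ^+ m.
have NP : (1%:M - N) *m P = 1%:M.
  (* The sign change produces the telescoping product [(N - 1) * P = N ^+ T.+1 - 1], whose power
     vanishes because it lies in band [T.+1]. *)
  transitivity (- ((N - 1) * P)); first by rewrite -mulNr opprB.
  by rewrite -subrX1 (lower_banded_full (lower_banded_exp hN)) sub0r opprK.
have [U _] := mulmx1_unit NP; split=> //.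
rewrite (mulmx1_invmx NP).
apply: (big_ind (@lower_banded R 0 a a)); first exact: lower_banded0.
  by move=> ? ?; exact: lower_bandedD.
move=> m _ i j ij; apply: (lower_banded_exp hN).
by rewrite addn0 in ij; rewrite ltn_addr.
Qed.

End BandedBlockMatrices.

(** * The stacked system, its closed loop and its responses *)

Section LTVSystem.
Variables (R : realType) (T : nat).

Lemma lower_banded_downshift (n : nat) : lower_banded 1 (downshift R T n).
Proof.
move=> i j; rewrite addn1 ltnS => ij; rewrite mxblockK.
by case: eqP ij => // ->; rewrite ltnn.
Qed.

Lemma lower_banded_blkdiag0 (a b : nat) (D : 'I_T -> 'M[R]_(a, b)) :
  lower_banded 0 (blkdiag0 D).
Proof.
move=> i j; rewrite addn0 => ij; rewrite mxblockK.
by case: eqP ij => // ->; rewrite ltnn.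
Qed.

Lemma block_lower_triangularP (a b : nat) (M : blockM R T a b) :
  block_lower_triangular M <-> lower_banded 0 M.
Proof.
by split=> hM i j ij; apply: hM; move: ij; rewrite addn0.
Qed.

Lemma downshift_stack (n : nat) (s : 'I_T.+1 -> 'cV[R]_n) :
  downshift R T n *m stack s =
  stack (fun i => oapp (fun t => s (lift ord_max t)) 0 (unlift ord0 i)).
Proof.
rewrite mul_mxblock_mxrow; apply: eq_mxcol => i.
case: (unliftP ord0 i) => [t|] ->; last first.
  by rewrite big1 // => j _; rewrite mul0mx.
(* In block row [t + 1] the only nonzero block of the downshift is in column [t]. *)
rewrite (bigD1 (lift ord_max t)) // lift0 lift_max eqxx mul1mx.
rewrite big1 => [|j neq]; first exact: addr0.
rewrite eqSS.
case: eqP => [tj|_]; last by rewrite mul0mx.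
by case/eqP: neq; apply: ord_inj; rewrite lift_max.
Qed.

Lemma blkdiag0_stack (a b : nat) (D : 'I_T -> 'M[R]_(a, b))
    (s : 'I_T.+1 -> 'cV[R]_b) :
  blkdiag0 D *m stack s =
  stack (fun i => oapp (fun t => D t *m s (lift ord_max t)) 0
                       (unlift ord_max i)).
Proof.
rewrite mul_mxblock_mxrow; apply: eq_mxcol => i.
rewrite (bigD1 i) //= eqxx big1 ?addr0; last first.
  by move=> j /negPf; rewrite eq_sym => ->; rewrite mul0mx.
by case: (unliftP ord_max i) => [t|] -> //=; rewrite mul0mx.
Qed.

Variables (n p : nat) (A : 'I_T -> 'M[R]_n) (B : 'I_T -> 'M[R]_(n, p)).

(** Block [t + 1] is the dynamics at time [t]; block [0] holds since the downshift puts zero there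
    and the stacked disturbance starts with the initial state. *)
Lemma ltv_trajectory_stack (x : 'I_T.+1 -> 'cV[R]_n)
    (u : 'I_T.+1 -> 'cV[R]_p) (w : 'I_T -> 'cV[R]_n) :
  ltv_trajectory A B x u w ->
  stack x = downshift R T n *m (blkdiag0 A *m stack x + blkdiag0 B *m stack u)
            + stack_dist (x ord0) w.
Proof.
move=> dyn; rewrite !blkdiag0_stack -mxcolD downshift_stack -mxcolD.
apply: eq_mxcol => i; case: (unliftP ord0 i) => [t|] -> /=.
  by rewrite liftK /= dyn.
by rewrite add0r.
Qed.

(** This is the stacked dynamics with disturbance [1%:M]: the columns of [Phix] and [Phiu] are
    responses to unit disturbances. *)
Lemma achievability_constraintE (Phix : blockM R T n n) (Phiu : blockM R T p n) :
  achievability_constraint A B Phix Phiu <->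
  Phix = 1%:M + downshift R T n *m (blkdiag0 A *m Phix + blkdiag0 B *m Phiu).
Proof.
rewrite /achievability_constraint mul_row_col mulmxBl mul1mx mulNmx.
rewrite -!mulmxA -addrA -opprD -mulmxDr.
by split=> [<-|{1}->]; rewrite ?subrK ?addrK.
Qed.

(** The column count [k] is free so that [M] can be a response matrix as well as a stacked
    signal. *)
Lemma closed_loop_mulE (k : nat) (K : blockM R T p n)
    (M : 'M[R]_(\sum_(i < T.+1) n, k)) :
  closed_loop_mx A B K *m M =
  M - downshift R T n *m (blkdiag0 A *m M + blkdiag0 B *m (K *m M)).
Proof. by rewrite mulmxBl mul1mx -!mulmxA mulmxDl mulmxA. Qed.

Lemma closed_loop_unit_inv (K : blockM R T p n) :
  block_lower_triangular K ->
  closed_loop_mx A B K \in unitmx /\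
  block_lower_triangular (invmx (closed_loop_mx A B K)).
Proof.
move=> /block_lower_triangularP hK; rewrite block_lower_triangularP.
apply: lower_banded_sub1_inv.
apply: (@lower_banded_mul _ _ 1 0); first exact: lower_banded_downshift.
apply: lower_bandedD; first exact: lower_banded_blkdiag0.
apply: (@lower_banded_mul _ _ 0 0) => //.
exact: lower_banded_blkdiag0.
Qed.

Lemma achievable_unit_inv (Phix : blockM R T n n) (Phiu : blockM R T p n) :
  block_lower_triangular Phix -> block_lower_triangular Phiu ->
  achievability_constraint A B Phix Phiu ->
  Phix \in unitmx /\ block_lower_triangular (invmx Phix).
Proof.
move=> /block_lower_triangularP hx /block_lower_triangularP hu.
move=> /achievability_constraintE ->; rewrite block_lower_triangularP.
(* [Phix] still occurs inside the added term, which does no harm: its triangularity alone makes that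
   term strictly lower. *)
rewrite -[X in 1%:M + X]opprK; apply: lower_banded_sub1_inv.
apply: lower_bandedN; apply: (@lower_banded_mul _ _ 1 0); first exact: lower_banded_downshift.
by apply: lower_bandedD; apply: (@lower_banded_mul _ _ 0 0) => //;
  exact: lower_banded_blkdiag0.
Qed.

Lemma achievable_response (Phix : blockM R T n n) (Phiu : blockM R T p n) :
  block_lower_triangular Phix -> block_lower_triangular Phiu ->
  achievability_constraint A B Phix Phiu ->
  block_lower_triangular (Phiu *m invmx Phix) /\
  system_response A B (Phiu *m invmx Phix) Phix Phiu.
Proof.
move=> hx hu hc; have [Ux ix] := achievable_unit_inv hx hu hc.
split.
  move: hu ix; rewrite !block_lower_triangularP => hu ix.
  by exact: (@lower_banded_mul _ _ 0 0).
have LPhi : closed_loop_mx A B (Phiu *m invmx Phix) *m Phix = 1%:M.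
  (* Since [K *m Phix] collapses to [Phiu], the goal becomes the fixed-point form of the
     constraint. *)
  rewrite closed_loop_mulE mulmxKV //.
  by move/achievability_constraintE: hc => {1}->; rewrite addrK.
have [UL _] := mulmx1_unit LPhi.
by split; rewrite ?(mulmx1_invmx LPhi) ?mulmxKV.
Qed.

Lemma response_achievable (K : blockM R T p n)
    (Phix : blockM R T n n) (Phiu : blockM R T p n) :
  block_lower_triangular K -> system_response A B K Phix Phiu ->
  [/\ block_lower_triangular Phix, block_lower_triangular Phiu
    & achievability_constraint A B Phix Phiu].
Proof.
move=> hK [U -> ->]; have [_ hx] := closed_loop_unit_inv hK.
split=> //.
  move: hK hx; rewrite !block_lower_triangularP => hK hx.
  by exact: (@lower_banded_mul _ _ 0 0).
(* Moving the feedback term to the left turns the constraint into the closed-loop matrix times its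
   own inverse. *)
apply/achievability_constraintE/eqP; rewrite -subr_eq -closed_loop_mulE.
by rewrite mulmxV.
Qed.

(** Eliminating the input by the feedback law leaves the closed-loop matrix times [stack x] equal to
    the disturbance, and inverting it gives both signals. *)
Lemma response_trajectory (K : blockM R T p n)
    (Phix : blockM R T n n) (Phiu : blockM R T p n)
    (x : 'I_T.+1 -> 'cV[R]_n) (u : 'I_T.+1 -> 'cV[R]_p)
    (w : 'I_T -> 'cV[R]_n) :
  system_response A B K Phix Phiu ->
  ltv_trajectory A B x u w -> stack u = K *m stack x ->
  stack x = Phix *m stack_dist (x ord0) w /\
  stack u = Phiu *m stack_dist (x ord0) w.
Proof.
move=> [U -> ->] /ltv_trajectory_stack dyn uK.
have Lx : closed_loop_mx A B K *m stack x = stack_dist (x ord0) w.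
  by rewrite closed_loop_mulE -uK {1}dyn addrC addKr.
by rewrite -mulmxA -Lx mulKmx.
Qed.

End LTVSystem.

Theorem theorem2p1 (R : realType) (T n p : nat)
    (A : 'I_T -> 'M[R]_n) (B : 'I_T -> 'M[R]_(n, p)) :
  (forall K : blockM R T p n,
     block_lower_triangular K -> closed_loop_mx A B K \in unitmx)
  /\
  (forall (Phix : blockM R T n n) (Phiu : blockM R T p n),
     [/\ block_lower_triangular Phix, block_lower_triangular Phiu
       & achievability_constraint A B Phix Phiu] <->
     exists K : blockM R T p n,
       block_lower_triangular K /\ system_response A B K Phix Phiu)
  /\
  (forall (Phix : blockM R T n n) (Phiu : blockM R T p n),
     block_lower_triangular Phix -> block_lower_triangular Phiu ->
     achievability_constraint A B Phix Phiu ->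
     let K := Phiu *m invmx Phix in
     [/\ Phix \in unitmx,
         block_lower_triangular K,
         system_response A B K Phix Phiu
       & forall (x : 'I_T.+1 -> 'cV[R]_n) (u : 'I_T.+1 -> 'cV[R]_p)
                (w : 'I_T -> 'cV[R]_n),
           ltv_trajectory A B x u w ->
           stack u = K *m stack x ->
           stack x = Phix *m stack_dist (x ord0) w /\
           stack u = Phiu *m stack_dist (x ord0) w]).
Proof.
split=> [K hK|]; first by case: (closed_loop_unit_inv A B hK).
split=> [Phix Phiu|Phix Phiu hx hu hc K].
  split=> [[hx hu hc]|[K [hK sysK]]]; last exact: response_achievable sysK.
  (* The explicit controller of the second part of the theorem is the witness for the first. *)
  by exists (Phiu *m invmx Phix); exact: achievable_response.
have [hK sysK] := achievable_response hx hu hc.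
have [Ux _] := achievable_unit_inv hx hu hc.
by split=> // x u w; exact: response_trajectory.
Qed.
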